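(* Let $0<\alpha<1$, $a<b$, and let $L:\mathbb{R}^2\to\mathbb{R}$, $(x,v)\mapsto L(x,v)$, be a smooth autonomous Lagrangian such that for every $x$ the map $v\mapsto\partial_2L(x,v)$ is bijective. Let $f$ be the associated Legendre transformation and $H(x,p)=p\,f(x,p)-L(x,f(x,p))$ the associated Hamiltonian. If $x(t)$ is a solution on $[a,b]$ of the causal fractional Euler-Lagrange equation $$\partial_1 L\big(x(t),{}_a\mathcal{D}_t^\alpha x(t)\big)-{}_a\mathcal{D}_t^\alpha\,\partial_2 L\big(x(t),{}_a\mathcal{D}_t^\alpha x(t)\big)=0,$$ and if $p(t)=\partial_2L\big(x(t),{}_a\mathcal{D}_t^\alpha x(t)\big)$, then $${}_a\mathcal{D}_t^\alpha x(t)=\partial_2H(x(t),p(t)),\qquad {}_a\mathcal{D}_t^\alpha p(t)=-\partial_1H(x(t),p(t)).$$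
   Context: $\partial_i$ denotes the partial derivative with respect to the $i$-th argument. The Legendre transformation is the map $f$ such that $v=f(x,p)$ is the unique solution of $p=\partial_2L(x,v)$. The left Caputo derivative is $${}_a\mathcal{D}_t^\alpha g(t)=\frac{1}{\Gamma(1-\alpha)}\int_a^t (t-\tau)^{-\alpha}g'(\tau)\,d\tau ,$$ and ${}_a\mathcal{D}_t^\alpha\,\partial_2 L(x(t),{}_a\mathcal{D}_t^\alpha x(t))$ means the left Caputo derivative of the function $t\mapsto\partial_2 L(x(t),{}_a\mathcal{D}_t^\alpha x(t))$. *)

(* Defs.v *)
From HB Require Import structures.
From mathcomp Require Import all_boot all_order all_algebra.
From mathcomp Require Import all_classical all_reals all_analysis.

Set Implicit Arguments.
Unset Strict Implicit.
Unset Printing Implicit Defensive.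
Import Order.TTheory GRing.Theory Num.Theory.
Import numFieldNormedType.Exports.
Local Open Scope classical_set_scope.
Local Open Scope ring_scope.

Definition partial1 {R : realType} (F : R -> R -> R) (x v : R) : R :=
  derive1 (fun y => F y v) x.

Definition partial2 {R : realType} (F : R -> R -> R) (x v : R) : R :=
  derive1 (F x) v.

(* Class C^n on the plane; continuity is joint in both arguments. *)
Fixpoint class_C {R : realType} (n : nat) (F : R -> R -> R) : Prop :=
  continuous (fun z : R * R => F z.1 z.2) /\
  match n with
  | 0%N => True
  | m.+1 =>
      [/\ forall x v : R, derivable (fun y => F y v) x 1,
          forall x v : R, derivable (F x) v 1,
          class_C m (partial1 F) &
          class_C m (partial2 F)]
  end.

Definition smooth {R : realType} (F : R -> R -> R) : Prop :=
  forall n : nat, class_C n F.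

Definition Gamma {R : realType} (z : R) : R :=
  \int[lebesgue_measure]_(s in `]0, +oo[) (s `^ (z - 1) * expR (- s)).

(* Left Caputo derivative. The open interval gives the same Lebesgue integral
   as the closed one and makes the value independent of [g] outside ]a, t[. *)
Definition caputo {R : realType} (alpha a : R) (g : R -> R) (t : R) : R :=
  (Gamma (1 - alpha))^-1 *
  \int[lebesgue_measure]_(tau in `]a, t[) ((t - tau) `^ (- alpha) * derive1 g tau).

(* [caputo alpha a g t] is meaningful, i.e. not a default value of [derive1] or of
   the integral. *)
Definition caputo_derivable {R : realType} (alpha a : R) (g : R -> R) (t : R)
    : Prop :=
  {ae lebesgue_measure, forall tau : R, tau \in `]a, t[ -> derivable g tau 1} /\
  lebesgue_measure.-integrable `]a, t[
    (fun tau : R => ((t - tau) `^ (- alpha) * derive1 g tau)%:E).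

Definition momentum {R : realType} (L : R -> R -> R) (alpha a : R)
    (x : R -> R) (t : R) : R :=
  partial2 L (x t) (caputo alpha a x t).

Definition causal_EL_solution {R : realType} (L : R -> R -> R)
    (alpha a b : R) (x : R -> R) : Prop :=
  forall t : R, t \in `[a, b] ->
    [/\ caputo_derivable alpha a x t,
        caputo_derivable alpha a (momentum L alpha a x) t &
        partial1 L (x t) (caputo alpha a x t) -
          caputo alpha a (momentum L alpha a x) t = 0].

Definition is_legendre {R : realType} (L f : R -> R -> R) : Prop :=
  forall x p : R, unique (fun v => p = partial2 L x v) (f x p).

Definition hamiltonian {R : realType} (L f : R -> R -> R) (x p : R) : R :=
  p * f x p - L x (f x p).

(* Main.v *)
Require Import Defs.
From HB Require Import structures.
From mathcomp Require Import all_boot all_order all_algebra.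
From mathcomp Require Import all_classical all_reals all_analysis.
From mathcomp Require Import lra.

Import Order.TTheory GRing.Theory Num.Theory.
Import numFieldNormedType.Exports.
Local Open Scope classical_set_scope.
Local Open Scope ring_scope.

(** The theorem reduces to two partial derivatives of the Hamiltonian,
    [partial2 H x p = f x p] and [partial1 H x p = - partial1 L x (f x p)].
    Since [f (x t) (p t)] is the Caputo derivative of [x] at [t], the first one
    is the first Hamilton equation, and the second one, combined with the
    Euler-Lagrange equation, is the second Hamilton equation.

    The bijection [partial2 L x] may have critical points (for instance
    [L x v = v ^+ 4] has [partial2 L x v = 4 * v ^+ 3]), so [f] need not be
    differentiable and the chain rule is not available. The two formulas are
    instances of the envelope principle instead. Fix [(x0, p0)], put
    [w = f x0 p0], and compare [H x p] with the function [p * w - L x w], which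
    is obtained by freezing the velocity at [w] and agrees with [H] at
    [(x0, p0)]. The difference is
    [p * (v - w) - (L x v - L x w)], where [v = f x p], so that
    [p = partial2 L x v]. By the mean value theorem and the monotonicity of the
    continuous injection [partial2 L x], it is at most
    [`|p - partial2 L x w| * `|v - w|] in absolute value
    ([hamiltonian_dist_le]). Along either coordinate line through [(x0, p0)],
    the first factor is the increment of a function differentiable at the base
    point, and the second one tends to [0], because [f] is continuous
    ([continuous_partial_inverse]). Hence the difference is negligible to first
    order, and [H] has the same partial derivatives as the function with frozen
    velocity ([is_derive_of_dist_le_mul], [is_derive_hamiltonian]). *)

Lemma continuous_inj_monotonic (R : realType) (g : R -> R) :
  continuous g -> injective g ->
  {homo g : v w / v < w} \/ {homo g : v w /~ v < w}.
Proof.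
move=> cg ig.
have [||mono|mono] := @itv_continuous_inj_mono R g `]-oo, +oo[.
- exact: continuous_subspaceT.
- by move=> v w _ _; exact: ig.
- by left=> v w; apply: mono; rewrite in_itv.
- by right=> v w; apply: mono; rewrite in_itv.
Qed.

Lemma dist_between (R : realType) (g : R -> R) (v w c : R) :
  continuous g -> injective g -> v <= c <= w \/ w <= c <= v ->
  `|g v - g c| <= `|g v - g w|.
Proof.
move=> cg ig bet.
have [] := @continuous_inj_monotonic R g cg ig.
- move=> /ltW_homo mono; case: bet => /andP[/mono l1 /mono l2].
  + by rewrite !ler0_norm ?subr_le0 ?(le_trans l1)//; lra.
  + by rewrite !ger0_norm ?subr_ge0 ?(le_trans l1)//; lra.
- move=> /ltW_nhomo mono; case: bet => /andP[/mono l1 /mono l2].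
  + by rewrite !ger0_norm ?subr_ge0 ?(le_trans l2)//; lra.
  + by rewrite !ler0_norm ?subr_le0 ?(le_trans l2)//; lra.
Qed.

Lemma MVT_between (R : realType) (f : R -> R) (v w : R) :
  (forall u, derivable f u 1) ->
  exists2 c, v <= c <= w \/ w <= c <= v & f v - f w = derive1 f c * (v - w).
Proof.
move=> df.
have mvt s t : s <= t -> exists2 c, s <= c <= t & f t - f s = derive1 f c * (t - s).
  move=> st; have [||c] := @MVT_segment R f (derive1 f) s t st.
  - by move=> u _; rewrite derive1E; exact/derivableP.
  - by apply: derivable_within_continuous => u _; exact: df.
  by rewrite in_itv/= => cst fE; exists c.
have [vw|/ltW wv] := leP v w.
- have [c cvw fE] := mvt _ _ vw; exists c; first by left.
  by rewrite -opprB fE -mulrN opprB.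
- by have [c cvw fE] := mvt _ _ wv; exists c; [right|].
Qed.

(** The left-hand side is the size of the Bregman divergence
    [f w - f v - derive1 f v * (w - v)]. The mean value theorem turns it into
    [(derive1 f v - derive1 f c) * (v - w)] with [c] between [v] and [w], and
    monotonicity of [derive1 f] replaces [c] by [w]. *)
Lemma bregman_le (R : realType) (f : R -> R) (v w : R) :
  (forall u, derivable f u 1) -> continuous (derive1 f) ->
  injective (derive1 f) ->
  `|derive1 f v * (v - w) - (f v - f w)|
    <= `|derive1 f v - derive1 f w| * `|v - w|.
Proof.
move=> df cdf idf; have [c bet ->] := @MVT_between R f v w df.
by rewrite -mulrBl normrM ler_wpM2r// dist_between.
Qed.

(** The increment of [d] is [O(y - x)] and that of [e] is [o(1)], so the product
    is [o(y - x)]: [F] and [G] touch to first order at [x]. Keeping the two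
    factors apart means that [e] only has to be continuous. *)
Lemma is_derive_of_dist_le_mul (R : realType) (F G d e : R -> R) (x a : R) :
  is_derive x 1 G a -> derivable d x 1 -> {for x, continuous e} ->
  (forall y, `|F y - G y| <= `|d y - d x| * `|e y - e x|) ->
  is_derive x 1 F a.
Proof.
move=> dG /derivableP /is_derive1_caratheodory[k [dE kc _]] ec FGle.
suff dr : is_derive x 1 (F - G) 0.
  by rewrite -[F](subrK G) -[a]add0r; exact: is_deriveD.
set r : R -> R := F - G.
have rx : r x = 0.
  by apply/eqP; rewrite -normr_le0 (le_trans (FGle x))// !subrr normr0 mul0r.
apply/is_derive1_caratheodory.
exists (fun y => r y / (y - x)); split; last by rewrite rx mul0r.
- move=> y; rewrite rx subr0; have [->|yx] := eqVneq y x.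
    by rewrite rx subrr mulr0.
  by rewrite divfK// subr_eq0.
- rewrite /prop_for /continuous_at rx mul0r.
  have ke0 : `|k y| * `|e y - e x| @[y --> x] --> 0.
    have e0 : (e y - e x) @[y --> x] --> e x - e x by exact: cvgB ec (cvg_cst _).
    have := cvgM (cvg_norm kc) (cvg_norm e0).
    by rewrite subrr normr0 mulr0; apply; exact: nbhs_filter.
  apply/cvgrPdist_lt => eps eps0; move/cvgrPdist_lt: ke0 => /(_ eps eps0).
  apply: filterS => y; rewrite !sub0r !normrN [ltLHS]ger0_norm ?mulr_ge0//.
  apply: le_lt_trans; have [->|yx] := eqVneq y x.
    by rewrite subrr invr0 mulr0 normr0 mulr_ge0.
  rewrite normrM normfV ler_pdivrMr ?normr_gt0 ?subr_eq0//.
  by rewrite (le_trans (FGle y))// dE normrM mulrAC.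
Qed.

Lemma continuous_slice1 (R : realType) (F : R -> R -> R) (v : R) :
  continuous (fun z : R * R => F z.1 z.2) -> continuous (F ^~ v).
Proof.
by move=> cF x; exact: continuous2_cvg (cF (x, v)) cvg_id (cvg_cst v).
Qed.

Lemma continuous_slice2 (R : realType) (F : R -> R -> R) (x : R) :
  continuous (fun z : R * R => F z.1 z.2) -> continuous (F x).
Proof.
by move=> cF v; exact: continuous2_cvg (cF (x, v)) (cvg_cst x) cvg_id.
Qed.

(** Joint continuity of the fibrewise inverse. That [f] stays within [e] of
    [v0] is certified by [g x (v0 - e) - p] and [g x (v0 + e) - p] having
    opposite signs, an open condition on [(x, p)] after which the intermediate
    value theorem locates the unique preimage of [p]. Expressing it by the sign
    of their product covers increasing and decreasing fibres together. *)
Lemma continuous_partial_inverse (R : realType) (g f : R -> R -> R) :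
  continuous (fun z : R * R => g z.1 z.2) ->
  (forall x, cancel (g x) (f x)) -> (forall x, cancel (f x) (g x)) ->
  continuous (fun z : R * R => f z.1 z.2).
Proof.
move=> cg gK fK [x0 p0].
have slice x : continuous (g x) by exact: continuous_slice2.
pose v0 := f x0 p0.
apply/cvgrPdist_le => e e0; rewrite /= -/v0.
pose S (z : R * R) := (g z.1 (v0 - e) - z.2) * (g z.1 (v0 + e) - z.2).
have cS : S z @[z --> (x0, p0)] --> S (x0, p0).
  have part v : (g z.1 v - z.2) @[z --> (x0, p0)] --> g x0 v - p0.
    apply: cvgB; last exact: cvg_snd.
    exact: continuous2_cvg (cg (x0, v)) cvg_fst (cvg_cst v).
  by apply: cvgM.
have S0 : S (x0, p0) < 0.
  have lv : v0 - e < v0 by rewrite ltrBlDr ltrDl.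
  have vu : v0 < v0 + e by rewrite ltrDl.
  have gv0 : g x0 v0 = p0 by exact: fK.
  have [mono|mono] := @continuous_inj_monotonic R _ (slice x0) (can_inj (gK x0)).
  - by rewrite nmulr_rlt0 ?subr_gt0 ?subr_lt0 /= -gv0; exact: mono.
  - by rewrite pmulr_rlt0 ?subr_gt0 ?subr_lt0 /= -gv0; exact: mono.
near=> z.
have Sz : S z < 0 by near: z; exact: cvgr_lt cS _ S0.
have [|||c] := @IVT R (g z.1) (v0 - e) (v0 + e) z.2.
- by rewrite lerD2l; lra.
- exact: continuous_subspaceT.
- rewrite ge_min le_max -[_ <= z.2]subr_le0 -[in X in _ || X]subr_le0 -!(subr_ge0 z.2); apply/andP; split.
  + apply: contraLR Sz; rewrite negb_or -!ltNge -leNgt => /andP[*].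
    by rewrite mulr_ge0 ?ltW.
  + apply: contraLR Sz; rewrite negb_or -!ltNge -leNgt => /andP[*].
    by rewrite mulr_le0 ?ltW.
rewrite in_itv/= => /andP[lc cu] gc.
by rewrite -gc gK ler_distlC lc cu.
Unshelve. all: by end_near. Qed.

(** The competitor [p * w - L x w] is the Hamiltonian with the velocity frozen
    at [w] instead of optimized at [f x p]; both factors on the right vanish
    when [w = f x p]. *)
Lemma hamiltonian_dist_le (R : realType) (L f : R -> R -> R) (x p w : R) :
  (forall v, derivable (L x) v 1) -> continuous (partial2 L x) ->
  injective (partial2 L x) -> cancel (f x) (partial2 L x) ->
  `|hamiltonian L f x p - (p * w - L x w)|
    <= `|p - partial2 L x w| * `|f x p - w|.
Proof.
move=> dL cg ig fK.
have := @bregman_le R (L x) (f x p) w dL cg ig.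
rewrite -/(partial2 L x (f x p)) -/(partial2 L x w) fK.
by rewrite /hamiltonian; congr (`|_| <= _); lra.
Qed.

(** The envelope formulas: each partial derivative of [hamiltonian L f] is that
    of [q * w - L y w] at fixed [w = f x p]. In the direction of the momentum
    the controlling factor is [q - p]; in the direction of the position it is
    [partial2 L x w - partial2 L y w], whence the use of the mixed second
    derivative of [L]. *)
Lemma is_derive_hamiltonian (R : realType) (L f : R -> R -> R) (x p : R) :
  smooth L -> (forall y, cancel (partial2 L y) (f y)) ->
  (forall y, cancel (f y) (partial2 L y)) ->
  is_derive p 1 (hamiltonian L f x) (f x p) /\
  is_derive x 1 (hamiltonian L f ^~ p) (- partial1 L x (f x p)).
Proof.
move=> /(_ 2)[_ [dL1 dL2 _ [cg [dg _ _ _]]]] gK fK.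
have slice y : continuous (partial2 L y) by exact: continuous_slice2.
have cf := @continuous_partial_inverse R _ _ cg gK fK.
have Hle y q := @hamiltonian_dist_le R L f y q (f x p) (dL2 y) (slice y)
                  (can_inj (gK y)) (fK y).
split.
- apply: (@is_derive_of_dist_le_mul R _ (fun q => q * f x p - L x (f x p))
           id (f x)).
  + have -> : (fun q => q * f x p - L x (f x p)) =
              f x p \*: id - cst (L x (f x p)).
      by apply/funext => q; rewrite mulrC.
    by apply: is_derive_eq; rewrite subr0; exact: mulr1.
  + exact: derivable_id.
  + exact: continuous_slice2.
  + by move=> q; have := Hle x q; rewrite fK.
- apply: (@is_derive_of_dist_le_mul R _ (fun y => p * f x p - L y (f x p))
           (partial2 L ^~ (f x p)) (f ^~ p)).
  + apply: is_derive_eq.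
      apply: (@is_deriveB _ _ _ (cst (p * f x p)) (L ^~ (f x p))).
      exact/derivableP/dL1.
    by rewrite sub0r /partial1 derive1E.
  + exact: dg.
  + exact: continuous_slice1.
  + by move=> y; have := Hle y p; rewrite fK (distrC p).
Qed.

Lemma near_eq_in_oo (R : realType) (g h : R -> R) (a t s : R) :
  {in `]a, t[, g =1 h} -> s \in `]a, t[ -> {near s, g =1 h}.
Proof. by move=> gh st; apply: filterS gh _; exact: near_in_itvoo. Qed.

Lemma eq_in_derive1 (R : realType) (g h : R -> R) (a t : R) :
  {in `]a, t[, g =1 h} -> {in `]a, t[, derive1 g =1 derive1 h}.
Proof.
move=> gh s st; rewrite !derive1E; apply: near_eq_derive.
exact: near_eq_in_oo st.
Qed.

(** The integral runs over the open interval, so the derivatives it involves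
    depend only on the restriction of the function to it. This lets [p], which
    is prescribed on [[a, b]] only, be exchanged with the momentum. *)
Lemma eq_caputo (R : realType) (alpha a t : R) (g h : R -> R) :
  {in `]a, t[, g =1 h} -> caputo alpha a g t = caputo alpha a h t.
Proof.
move=> gh; congr (_ * _); apply: eq_Rintegral => s; rewrite inE => st.
by rewrite (@eq_in_derive1 R g h a t).
Qed.

Lemma eq_caputo_derivable (R : realType) (alpha a t : R) (g h : R -> R) :
  {in `]a, t[, g =1 h} ->
  caputo_derivable alpha a g t -> caputo_derivable alpha a h t.
Proof.
move=> gh [dg ig]; split.
- move: dg; apply: filterS.
    exact: (ae_filter_ringOfSetsType lebesgue_measure).
  by move=> s dgs st; apply: near_eq_derivable (dgs st); exact: near_eq_in_oo st.
- apply: eq_integrable ig => // s; rewrite inE => st.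
  by rewrite (@eq_in_derive1 R g h a t).
Qed.

Theorem theorem6 (R : realType) (alpha a b : R) (L f : R -> R -> R)
    (x p : R -> R)
    (halpha : 0 < alpha < 1) (hab : a < b)
    (hL : smooth L)
    (hbij : forall y : R, bijective (partial2 L y))
    (hf : is_legendre L f)
    (hx : causal_EL_solution L alpha a b x)
    (hp : forall t : R, t \in `[a, b] ->
            p t = partial2 L (x t) (caputo alpha a x t)) :
  let H := hamiltonian L f in
  forall t : R, t \in `[a, b] ->
    [/\ derivable (fun y => H y (p t)) (x t) 1,
        derivable (H (x t)) (p t) 1,
        caputo_derivable alpha a p t,
        caputo alpha a x t = partial2 H (x t) (p t) &
        caputo alpha a p t = - partial1 H (x t) (p t)].
Proof.
move=> H t tab.
have fK y : cancel (f y) (partial2 L y) by move=> q; have [] := hf y q.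
have gK y : cancel (partial2 L y) (f y).
  by move=> v; have [_] := hf y (partial2 L y v); exact.
have [_ dp EL] := hx t tab.
have mp : {in `]a, t[, momentum L alpha a x =1 p}.
  move=> s; rewrite in_itv/= => /andP[a_s s_t]; rewrite hp//.
  move: tab; rewrite !in_itv/= => /andP[_ t_b].
  by rewrite (ltW a_s) (le_trans (ltW s_t)).
have fp : f (x t) (p t) = caputo alpha a x t by rewrite hp// gK.
have [d2 d1] := @is_derive_hamiltonian R L f (x t) (p t) hL gK fK.
split.
- by case: d1.
- by case: d2.
- exact: eq_caputo_derivable mp dp.
- by rewrite /partial2 derive1E; case: d2 => _ ->.
- rewrite /partial1 derive1E; case: d1 => _ ->; rewrite fp opprK.
  rewrite -(@eq_caputo R alpha a t _ _ mp).
  by apply/esym/eqP; rewrite -subr_eq0 EL.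
Qed.
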